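(* Let $n\ge 1$, let $I\subseteq\{1,\ldots,n\}$ and let $S=\bigcup_{i\in I}O_i\subseteq Z_2^n$. Then the eigenvalues of the orbit Cayley graph $Cay(Z_2^n,S)$ consist of $\lambda_k(S)$ with multiplicity $\binom{n}{k}$ for $0\le k\le n$, where $$\lambda_k(S)=\sum_{i\in I}\sum_{j=0}^{i}\binom{k}{j}\binom{n-k}{i-j}(-1)^j .$$ (The spectrum is the multiset union over $k=0,\ldots,n$; the values $\lambda_k(S)$ need not be distinct for distinct $k$.)
   Context: $Z_2^n$ is the elementary abelian $2$-group of rank $n$, viewed as the vector space $F_2^n$. For $v=(a_1,\ldots,a_n)^T\in Z_2^n$, $|v|$ is the number of coordinates of $v$ equal to $1$, and $O_i=\{v\in Z_2^n : |v|=i\}$ for $0\le i\le n$. For a group $G$ and $S\subseteq G$ with $1\notin S$ and $S=S^{-1}$, the Cayley graph $Cay(G,S)$ has vertex set $G$, with $x,y$ adjacent iff $x^{-1}y\in S$. An orbit Cayley graph over $Z_2^n$ is a graph $Cay(Z_2^n,S)$ where $S$ is a union of some of the $O_i$. The eigenvalues of a graph are those of its adjacency matrix. Convention: $\binom{s}{t}=0$ if $t<0$ or $t>s$. *)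

(* Defs.v *)
From HB Require Import structures.
From mathcomp Require Import all_boot all_order all_fingroup all_algebra.
Set Implicit Arguments.
Unset Strict Implicit.
Unset Printing Implicit Defensive.
Import Order.TTheory GRing.Theory Num.Theory.
Local Open Scope ring_scope.

(* The group law of this finGroupType is the addition of column vectors. *)
Notation Z2 n := ('cV['F_2]_n).

Definition hweight n (v : Z2 n) : nat := #|[set a | v a 0 == 1]|.

Definition layer n (i : nat) : {set Z2 n} := [set v | hweight v == i].

Definition layers n (I : {set 'I_n.+1}) : {set Z2 n} := \bigcup_(i in I) layer n i.

Definition cayley (gT : finGroupType) (S : {set gT}) : rel gT :=
  fun x y => (x^-1 * y)%g \in S.

Lemma cayley_irreflexive (gT : finGroupType) (S : {set gT}) :
  1%g \notin S -> irreflexive (cayley S).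
Proof. by move=> S1 x; rewrite /cayley mulVg; apply: negbTE. Qed.

Lemma cayley_symmetric (gT : finGroupType) (S : {set gT}) :
  (S^-1)%g = S -> symmetric (cayley S).
Proof.
by move=> SV x y; rewrite /cayley -{1}SV mem_invg invMg invgK.
Qed.

Lemma layers_not1 n (I : {set 'I_n.+1}) : ord0 \notin I -> 1%g \notin layers I.
Proof.
move=> I0; apply/bigcupP => -[i iI]; rewrite inE /hweight.
rewrite (_ : [set a | _] = set0) ?cards0; last first.
  by apply/setP=> a; rewrite !inE mxE.
by move=> /eqP i0; case/negP: I0; rewrite (_ : ord0 = i) //; apply: val_inj.
Qed.

Lemma layers_invg n (I : {set 'I_n.+1}) : (layers I)^-1%g = layers I.
Proof.
apply/setP=> v; rewrite mem_invg.
suff -> : (v^-1)%g = v by [].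
apply/matrixP=> a b; rewrite mxE.
by case: (v a b) => -[|[|]] // ?; apply: val_inj.
Qed.

Lemma cayley_layersE n (I : {set 'I_n.+1}) (x y : Z2 n) :
  cayley (layers I) x y = (- x + y \in layers I).
Proof. by []. Qed.

Definition adjmx (R : nzRingType) (T : finType) (e : rel T) : 'M[R]_#|T| :=
  \matrix_(i, j) (e (enum_val i) (enum_val j))%:R.

(* s lists the eigenvalues of A, each repeated according to its (algebraic)
   multiplicity; in particular the characteristic polynomial splits. *)
Definition is_spectrum (R : fieldType) m (A : 'M[R]_m) (s : seq R) : Prop :=
  char_poly A = \prod_(x <- s) ('X - x%:P).

Lemma is_spectrum_eigenvalue (R : fieldType) m (A : 'M[R]_m) (s : seq R) :
  is_spectrum A s -> eigenvalue A =i s.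
Proof.
by move=> As x; rewrite [LHS]eigenvalue_root_char As root_prod_XsubC.
Qed.

(* For k <= n, the only case used, n - k and i - j involve no truncation, and
   'C(s, t) = 0 when t > s. *)
Definition lambda (R : nzRingType) n (I : {set 'I_n.+1}) (k : nat) : R :=
  \sum_(i in I) \sum_(0 <= j < i.+1)
    'C(k, j)%:R * 'C(n - k, i - j)%:R * (-1) ^+ j.

(* Main.v *)
Require Import Defs.
From HB Require Import structures.
From mathcomp Require Import all_boot all_order all_fingroup all_algebra.
Set Implicit Arguments.
Unset Strict Implicit.
Unset Printing Implicit Defensive.
Import Order.TTheory GRing.Theory Num.Theory.
Local Open Scope ring_scope.

(** The adjacency matrix of a Cayley graph of an abelian group is diagonalized
    by the characters of the group.  For the group of binary vectors these are
    the signs (-1) ^ (number of common ones of u and v), called [walsh R u v]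
    below, and the eigenvalue belonging to u is the sum of that character over
    the connection set.

    Everything else is read off one identity, [walsh_enumerator]: the sum over
    v of [walsh u v * t ^ |v|] factors over the coordinates, and hence equals
    (1 - t) ^ |u| * (1 + t) ^ (n - |u|).
    - With t an indeterminate, the coefficient of t ^ i is the sum of the
      character over the vectors of weight i; expanding the two binomials gives
      the inner sum of [lambda R I |u|] ([sum_walsh_layer], [sum_walsh_layers]).
    - With t = 1, it gives the orthogonality of the characters
      ([sum_walsh]), so that the character table W satisfies W * W = 2 ^ n and
      is invertible in characteristic 0 ([walshmx_sqr]).
    - With u = 0, it counts the vectors of weight i ([card_layer]).

    Thus the adjacency matrix is similar to the diagonal matrix whose entry at
    u is [lambda R I |u|], and grouping the indices u by weight k gives each
    [lambda R I k] with multiplicity 'C(n, k). *)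

(** * Characters of the group of binary vectors *)

Definition walsh (R : comNzRingType) n (u v : Z2 n) : R :=
  \prod_a (-1) ^+ ((u a 0 == 1) && (v a 0 == 1)).

Lemma walshC (R : comNzRingType) n (u v : Z2 n) : walsh R u v = walsh R v u.
Proof. by apply: eq_bigr => a _; rewrite andbC. Qed.

Lemma walshDr (R : comNzRingType) n (u v w : Z2 n) :
  walsh R u (v + w) = walsh R u v * walsh R u w.
Proof.
rewrite /walsh -big_split; apply: eq_bigr => a _; rewrite mxE /=.
case: (u a 0 == 1); last by rewrite mulr1.
by case: (v a 0) (w a 0) => -[|[|]] // ? [[|[|]] //] ?;
   rewrite /= ?mulr1 ?mul1r // mulrNN mulr1.
Qed.

Lemma walsh0l (R : comNzRingType) n (v : Z2 n) : walsh R 0 v = 1.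
Proof. by apply: big1 => a _; rewrite mxE. Qed.

Lemma rmorph_walsh (R S : comNzRingType) (f : {rmorphism R -> S}) n
    (u v : Z2 n) : f (walsh R u v) = walsh S u v.
Proof. by rewrite rmorph_prod; apply: eq_bigr => a _; rewrite rmorph_sign. Qed.

(** Binary vectors are functions from coordinates to ['F_2], so this is the
    distributivity of a product of sums; it is what makes the enumerator below
    a product over the coordinates. *)
Lemma sum_prod_coords (R : comNzRingType) n (F : 'I_n -> 'F_2 -> R) :
  \sum_(v : Z2 n) \prod_a F a (v a 0) = \prod_a \sum_c F a c.
Proof.
rewrite bigA_distr_bigA /=.
have bij_col : bijective (fun f : {ffun 'I_n -> 'F_2} => \col_a f a).
  exists (fun v : Z2 n => [ffun a => v a 0]) => [f | v].
    by apply/ffunP=> a; rewrite ffunE mxE.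
  by apply/colP=> a; rewrite mxE ffunE.
rewrite (reindex _ (onW_bij _ bij_col)) /=.
by apply: eq_bigr => f _; apply: eq_bigr => a _; rewrite mxE.
Qed.

(** * The weight enumerator of a character *)

Lemma expr_hweight (R : comNzRingType) n (v : Z2 n) (t : R) :
  t ^+ hweight v = \prod_a t ^+ (v a 0 == 1).
Proof.
rewrite prodrXr /hweight -sum1dep_card big_mkcond /=.
by congr (_ ^+ _); apply: eq_bigr => a _; case: eqP.
Qed.

Lemma hweight_le n (v : Z2 n) : (hweight v <= n)%N.
Proof. by rewrite -[leqRHS]card_ord max_card. Qed.

Lemma hweight_eq0 n (v : Z2 n) : (hweight v == 0%N) = (v == 0).
Proof.
rewrite cards_eq0; apply/eqP/eqP => [/setP v0 | ->]; last first.
  by apply/setP=> a; rewrite !inE mxE.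
apply/colP=> a; have:= v0 a; rewrite !inE mxE.
by case: (v a 0) => -[|[|]] // ? _; apply: val_inj.
Qed.

(** Both the character and [t ^ |v|] are products of local factors, so the sum
    splits: a coordinate with [u a 0 = 1] contributes 1 - t, any other one
    contributes 1 + t. *)
Lemma walsh_enumerator (R : comNzRingType) n (u : Z2 n) (t : R) :
  \sum_v walsh R u v * t ^+ hweight v
    = (1 - t) ^+ hweight u * (1 + t) ^+ (n - hweight u).
Proof.
pose F a (c : 'F_2) : R := (-1) ^+ ((u a 0 == 1) && (c == 1)) * t ^+ (c == 1).
transitivity (\prod_a \sum_c F a c).
  rewrite -sum_prod_coords; apply: eq_bigr => v _.
  by rewrite expr_hweight -big_split.
have FE a : \sum_c F a c = if u a 0 == 1 then 1 - t else 1 + t.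
  by rewrite !big_ord_recl big_ord0 /F /=; case: eqP => _ /=;
     rewrite ?mul1r ?mulr1 ?mulN1r addr0.
under eq_bigr do rewrite FE.
rewrite (bigID (fun a => u a 0 == 1)) /=; congr (_ * _).
  by rewrite -[hweight u]/#|_| -prodr_const; apply: eq_big => a;
     rewrite ?inE // => /eqP->.
have -> : (n - hweight u)%N = #|~: [set a | u a 0 == 1]|.
  by rewrite [RHS]cardsCs setCK card_ord.
by rewrite -prodr_const; apply: eq_big => a; rewrite ?inE // => /negPf->.
Qed.

Lemma coef_1DZX_exp (R : comNzRingType) (c : R) m i :
  ((1 + c *: 'X) ^+ m)`_i = 'C(m, i)%:R * c ^+ i.
Proof.
rewrite exprDn coef_sum.
under eq_bigr do rewrite expr1n mul1r coefMn exprZn coefZ coefXn.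
have [im|mi] := leqP i m.
  rewrite (bigD1 (Ordinal (im : (i < m.+1)%N))) //= eqxx mulr1 mulr_natl.
  rewrite big1 ?addr0 // => j.
  by rewrite -val_eqE /= eq_sym => /negPf->; rewrite mulr0 mul0rn.
rewrite bin_small // mul0r big1 // => j _.
by rewrite gtn_eqF ?mulr0 ?mul0rn // (leq_trans (ltn_ord j) mi).
Qed.

(** Comparing the coefficients of ['X^i] in the enumerator at t = ['X]; the
    right-hand side is the value at |u| of the i-th Krawtchouk polynomial. *)
Lemma sum_walsh_layer (R : comNzRingType) n (u : Z2 n) i :
  \sum_(v in layer n i) walsh R u v
    = \sum_(0 <= j < i.+1)
        'C(hweight u, j)%:R * 'C(n - hweight u, i - j)%:R * (-1) ^+ j.
Proof.
have:= congr1 (fun p : {poly R} => p`_i) (walsh_enumerator u 'X).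
rewrite coef_sum coefM big_mkord => E; rewrite big_mkcond /=.
transitivity (\sum_v (walsh {poly R} u v * 'X^(hweight v))`_i).
  apply: eq_bigr => v _; rewrite -(rmorph_walsh polyC) coefCM coefXn inE eq_sym.
  by case: eqP => _; rewrite ?mulr1 ?mulr0.
rewrite E; apply: eq_bigr => j _.
rewrite -scaleN1r coef_1DZX_exp -['X]scale1r coef_1DZX_exp expr1n mulr1.
by rewrite mulrAC.
Qed.

(** The trivial character sums to the number of vectors, and only the term
    j = 0 of the Krawtchouk sum survives. *)
Lemma card_layer n i : #|layer n i| = 'C(n, i).
Proof.
(* The identity lives in a ring; the integers make the cast injective. *)
apply/eqP; rewrite -eqz_nat; apply/eqP; rewrite -!natz.
have:= sum_walsh_layer int (0 : Z2 n) i.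
under eq_bigr do rewrite walsh0l.
have/eqP-> : hweight (0 : Z2 n) == 0%N by rewrite hweight_eq0.
rewrite sumr_const => ->; rewrite big_ltn // big1_seq => [|[|j]].
- by rewrite bin0 mul1r mulr1 !subn0 addr0.
- by rewrite mem_index_iota.
- by rewrite mul0r mul0r.
Qed.

Lemma sum_walsh_layers (R : comNzRingType) n (I : {set 'I_n.+1}) (u : Z2 n) :
  \sum_(v in layers I) walsh R u v = lambda R I (hweight u).
Proof.
(* Extended by the empty set outside I, the layers form a pairwise disjoint
   family over the whole index type. *)
pose L (i : 'I_n.+1) := if i \in I then layer n i else set0.
have -> : layers I = \bigcup_i L i by rewrite /layers big_mkcond.
rewrite partition_disjoint_bigcup => [|i j neq_ij].
  rewrite /lambda [RHS]big_mkcond; apply: eq_bigr => i _; rewrite /L.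
  by case: ifP => _; rewrite ?sum_walsh_layer ?big_set0.
rewrite /L; case: ifP; case: ifP => _ _;
  rewrite -?setI_eq0 ?set0I ?setI0 ?eqxx //.
apply/eqP/setP=> v; rewrite !inE; apply/negP=> /andP[/eqP vi /eqP vj].
by case/eqP: neq_ij; apply: val_inj; rewrite /= -vi.
Qed.

(** At t = 1 the factor 1 - t kills the enumerator as soon as u has a nonzero
    coordinate. *)
Lemma sum_walsh (R : comNzRingType) n (u : Z2 n) :
  \sum_v walsh R u v = if u == 0 then 2 ^+ n else 0.
Proof.
have:= walsh_enumerator u (1 : R).
under eq_bigr do rewrite expr1n mulr1.
rewrite subrr expr0n hweight_eq0 => ->.
case: eqP => [-> | _]; last by rewrite mul0r.
have/eqP-> : hweight (0 : Z2 n) == 0%N by rewrite hweight_eq0.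
by rewrite mul1r subn0.
Qed.

(** * Diagonalization *)

Definition walshmx (R : comNzRingType) n : 'M[R]_#|{: Z2 n}| :=
  \matrix_(i, j) walsh R (enum_val i) (enum_val j).

Lemma addZ2_eq0 n (u v : Z2 n) : (u + v == 0) = (u == v).
Proof.
have oppZ2 : - v = v.
  apply/colP=> a; rewrite mxE.
  by case: (v a 0) => -[|[|]] // ?; apply: val_inj.
by rewrite -{1}oppZ2 subr_eq0.
Qed.

(** The table is symmetric and [walsh u * walsh v = walsh (u + v)], so the
    entries of the square are sums of a single character, which is trivial
    exactly when u = v. *)
Lemma walshmx_sqr (R : comNzRingType) n :
  walshmx R n *m walshmx R n = (2 ^+ n)%:M.
Proof.
apply/matrixP=> i j; rewrite !mxE.
transitivity (\sum_v walsh R (enum_val i + enum_val j) v).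
  rewrite [RHS]big_enum_val; apply: eq_bigr => k _; rewrite !mxE.
  by rewrite walshC -walshDr walshC.
rewrite sum_walsh addZ2_eq0 (inj_eq enum_val_inj).
by case: eqP.
Qed.

(** The relation lifts to the characteristic matrices, and the determinant of P
    can then be cancelled in the integral domain of polynomials. *)
Lemma char_poly_intertwine (R : idomainType) m (A B P : 'M[R]_m) :
  \det P != 0 -> A *m P = P *m B -> char_poly A = char_poly B.
Proof.
move=> detP AP; have detPX : \det (map_mx polyC P) != 0.
  by rewrite det_map_mx polyC_eq0.
apply: (mulIf detPX); rewrite -det_mulmx [RHS]mulrC -det_mulmx; congr (\det _).
rewrite mulmxBl mulmxBr -!map_mxM AP; congr (_ - _).
by rewrite -scalar_mxC.
Qed.

(** Characters are eigenvectors: substituting y = x + v in the sum over the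
    neighbours y of x, multiplicativity extracts [walsh u x] and leaves the sum
    of the character over the connection set. *)
Lemma adjmx_layers_walshmx (R : comNzRingType) n (I : {set 'I_n.+1}) :
  adjmx R (cayley (layers I)) *m walshmx R n
    = walshmx R n *m diag_mx (\row_j lambda R I (hweight (enum_val j))).
Proof.
apply/matrixP=> i j; rewrite mul_mx_diag !mxE.
set x : Z2 n := enum_val i; set u : Z2 n := enum_val j.
transitivity (\sum_(y : Z2 n) (- x + y \in layers I)%:R * walsh R y u).
  rewrite [RHS]big_enum_val; apply: eq_bigr => k _.
  by rewrite !mxE.
rewrite (reindex_inj (addrI x)) -sum_walsh_layers mulr_sumr [RHS]big_mkcond.
apply: eq_bigr => v _ /=; rewrite addKr ![walsh R _ u]walshC walshDr.
by case: ifP; rewrite ?mul1r ?mul0r.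
Qed.

Theorem theorem1 (R : numFieldType) (n : nat) (hn : (1 <= n)%N)
    (I : {set 'I_n.+1}) (hI : ord0 \notin I) :
  is_spectrum (adjmx R (cayley (layers I)))
    (flatten [seq nseq 'C(n, k) (lambda R I k) | k <- iota 0 n.+1]).
Proof.
have detW : \det (walshmx R n) != 0.
  have: \det (walshmx R n *m walshmx R n) != 0.
    by rewrite walshmx_sqr det_scalar !expf_neq0 ?pnatr_eq0.
  by rewrite det_mulmx mulf_eq0 orbb.
rewrite /is_spectrum (char_poly_intertwine detW (adjmx_layers_walshmx R I)).
rewrite char_poly_trig ?diag_mx_is_trig //.
rewrite big_flatten big_map -[iota 0 n.+1]/(index_iota 0 n.+1) big_mkord.
under [LHS]eq_bigr do rewrite !mxE eqxx /=.
under [RHS]eq_bigr do rewrite big_nseq iter_mulr_1 -card_layer.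
transitivity (\prod_(v : Z2 n) ('X - (lambda R I (hweight v))%:P)).
  by rewrite [RHS]big_enum_val.
(* Weights are at most n, so [inord] does not truncate. *)
rewrite (partition_big (fun v => inord (hweight v) : 'I_n.+1) predT) //=.
apply: eq_bigr => k _.
rewrite -prodr_const; apply: eq_big => v.
  by rewrite inE -val_eqE /= inordK ?ltnS ?hweight_le.
by move=> /eqP<-; rewrite inordK ?ltnS ?hweight_le.
Qed.
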